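(* Let $R$ be an integral domain which is a Hilbert ring. Then every radical ideal $I$ of $R[X]$ which is a finite intersection of G-ideals of $R[X]$ is power stable.
   Context: A ring is a Hilbert ring if every prime ideal is an intersection of maximal ideals. A prime ideal $Q$ of a ring $A$ is a G-ideal if the fraction field of $A/Q$ is finitely generated as an algebra over $A/Q$. An ideal $I$ of the polynomial ring $R[X]$ over an integral domain $R$ is called power stable if $I^t\cap R = (I\cap R)^t$ for all integers $t\geq 1$. *)

(* Defs.v *)
From HB Require Import structures.
From mathcomp Require Import all_boot all_order all_algebra.
Set Implicit Arguments. Unset Strict Implicit. Unset Printing Implicit Defensive.
Import GRing.Theory.
Local Open Scope ring_scope.

Section IdealDefs.
Variable A : comNzRingType.

Definition is_ideal (I : A -> Prop) : Prop :=
  [/\ I 0, (forall x y, I x -> I y -> I (x + y)) & (forall r x, I x -> I (r * x))].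

Definition is_prime_ideal (P : A -> Prop) : Prop :=
  [/\ is_ideal P, ~ P 1 & (forall a b, P (a * b) -> P a \/ P b)].

Definition is_maximal_ideal (M : A -> Prop) : Prop :=
  [/\ is_ideal M, ~ M 1 &
      (forall J : A -> Prop, is_ideal J -> (forall x, M x -> J x) ->
         J 1 \/ (forall x, J x -> M x))].

Definition is_radical_ideal (I : A -> Prop) : Prop :=
  is_ideal I /\ (forall x n, I (x ^+ n) -> I x).

Definition hilbert_ring : Prop :=
  forall P, is_prime_ideal P ->
    exists F : (A -> Prop) -> Prop,
      (forall M, F M -> is_maximal_ideal M) /\
      (forall x, P x <-> (forall M, F M -> M x)).

Inductive ideal_gen (S : A -> Prop) : A -> Prop :=
  | ig0 : ideal_gen S 0
  | igS r s : S s -> ideal_gen S (r * s)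
  | igD x y : ideal_gen S x -> ideal_gen S y -> ideal_gen S (x + y).

Fixpoint ideal_pow (I : A -> Prop) (t : nat) : A -> Prop :=
  match t with
  | O => fun _ => True
  | S t' => ideal_gen (fun z => exists x y, ideal_pow I t' x /\ I y /\ z = x * y)
  end.

(* The fraction field of A/P (P prime) is modelled literally as pairs (a, b)
   with b not in P, where (a,b) ~ (a',b') iff a b' - a' b in P.
   frac_subalg P gs x : the class of x lies in the (A/P)-subalgebra of
   Frac(A/P) generated by the fractions in gs. *)
Inductive frac_subalg (P : A -> Prop) (gs : seq (A * A)) : A * A -> Prop :=
  | fsC a : frac_subalg P gs (a, 1)
  | fsG g : g \in gs -> frac_subalg P gs g
  | fsD x y : frac_subalg P gs x -> frac_subalg P gs y ->
      frac_subalg P gs (x.1 * y.2 + y.1 * x.2, x.2 * y.2)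
  | fsM x y : frac_subalg P gs x -> frac_subalg P gs y ->
      frac_subalg P gs (x.1 * y.1, x.2 * y.2)
  | fsE x y : frac_subalg P gs x -> ~ P y.2 -> P (x.1 * y.2 - y.1 * x.2) ->
      frac_subalg P gs y.

Definition is_G_ideal (Q : A -> Prop) : Prop :=
  is_prime_ideal Q /\
  exists gs : seq (A * A),
    (forall g, g \in gs -> ~ Q g.2) /\
    (forall a b, ~ Q b -> frac_subalg Q gs (a, b)).

End IdealDefs.

Definition contract (R : idomainType) (I : {poly R} -> Prop) : R -> Prop :=
  fun r => I r%:P.

Definition power_stable (R : idomainType) (I : {poly R} -> Prop) : Prop :=
  forall t : nat, (1 <= t)%N ->
    forall r : R, contract (ideal_pow I t) r <-> ideal_pow (contract I) t r.

(* Main.v *)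
(* Write p for the contraction of a G-ideal Q of R[X]. Some b outside Q has a
   power divisible, modulo Q, by any given element outside Q; since k[X] has no
   such b, Q contains a polynomial f of least degree d > 0 modulo p, and
   b h = c modulo Q for some constant c outside p. Choose a maximal ideal M
   containing p but not c or the leading coefficient a of f. If some y of M were
   outside p, then c^k - y g would lie in Q, so f would divide a^N c^k in (R/M)[X],
   which is absurd for degree reasons; hence p = M is maximal.

   For m = p maximal, Q = m[X] + (f) with f = 0 or f monic of positive degree.
   Then Q^t is contained in m^t[X] + (f), which contracts to m^t. Finally the
   powers of distinct maximal ideals are comaximal, so the intersection of the
   m_i^t is contained in the t-th power of the intersection of the m_i. *)
Require Import Defs.
From mathcomp Require Import all_boot all_order all_algebra.
From mathcomp Require Import ring zify.
From Stdlib Require Import Classical.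

Set Implicit Arguments.
Unset Strict Implicit.
Unset Printing Implicit Defensive.
Import GRing.Theory.
Local Open Scope ring_scope.

Lemma ex_least (P : nat -> Prop) :
  (exists n, P n) -> exists n, P n /\ forall k, P k -> (n <= k)%N.
Proof.
move=> [n Pn]; apply: NNPP => noleast.
suff H : forall k i, (i < k)%N -> ~ P i by exact: (H n.+1 n).
elim=> // k IHk i; rewrite ltnS => le_ik Pi; apply: noleast.
exists i; split=> // j Pj; rewrite leqNgt; apply/negP => lt_ji.
exact: IHk j (leq_trans lt_ji le_ik) Pj.
Qed.

(** * Ideals and their powers in a commutative ring *)

Section Ideals.
Variable A : comNzRingType.
Implicit Types (I J K M P : A -> Prop) (x y : A).

Section Closure.
Variables (I : A -> Prop) (idI : is_ideal I).

Lemma ideal0 : I 0. Proof. by case: idI. Qed.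

Lemma idealD x y : I x -> I y -> I (x + y).
Proof. by case: idI => _ + _; apply. Qed.

Lemma idealMl x y : I y -> I (x * y).
Proof. by case: idI => _ _; apply. Qed.

Lemma idealMr x y : I x -> I (x * y).
Proof. by rewrite mulrC; apply: idealMl. Qed.

Lemma idealN x : I x -> I (- x).
Proof. by rewrite -mulN1r; apply: idealMl. Qed.

Lemma idealB x y : I x -> I y -> I (x - y).
Proof. by move=> Ix Iy; apply: idealD => //; apply: idealN. Qed.

Lemma idealBl x y : I (x - y) -> I y -> I x.
Proof. by move=> Ixy Iy; rewrite -(subrK y x); apply: idealD. Qed.

Lemma idealBr x y : I (x - y) -> I x -> I y.
Proof. by move=> Ixy Ix; rewrite -(subKr x y); apply: idealB. Qed.

Lemma ideal_sum (T : Type) (s : seq T) (C : pred T) (F : T -> A) :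
  (forall i, C i -> I (F i)) -> I (\sum_(i <- s | C i) F i).
Proof. by move=> IF; apply: (big_ind I) => //; [apply: ideal0 | apply: idealD]. Qed.

Lemma ideal_subX x y k : I (x - y) -> I (x ^+ k - y ^+ k).
Proof. by rewrite subrXX; apply: idealMr. Qed.

End Closure.

Lemma prime_idealX P x k : is_prime_ideal P -> ~ P x -> ~ P (x ^+ k).
Proof.
move=> [_ P1 PM] Px; elim: k => [|k IHk]; first by rewrite expr0.
by rewrite exprS => /PM [].
Qed.

Lemma ideal_gen_ideal (S : A -> Prop) : is_ideal (ideal_gen S).
Proof.
split=> [|x y|r x]; [exact: ig0 | exact: igD|].
elim=> [|r' s Ss|y z _ IHy _ IHz]; first by rewrite mulr0; apply: ig0.
  by rewrite mulrA; apply: igS.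
by rewrite mulrDr; apply: igD.
Qed.

Lemma ideal_gen_min (S : A -> Prop) I :
  is_ideal I -> (forall x, S x -> I x) -> forall x, ideal_gen S x -> I x.
Proof.
move=> idI SI x; elim=> [|r s /SI|y z _ Iy _ Iz]; first exact: ideal0.
  exact: idealMl.
exact: idealD.
Qed.

Lemma ideal_gen_inc (S : A -> Prop) x : S x -> ideal_gen S x.
Proof. by move=> Sx; rewrite -(mul1r x); apply: igS. Qed.

Lemma ideal_pow_ideal I t : is_ideal (ideal_pow I t).
Proof. by case: t => [|t] //; apply: ideal_gen_ideal. Qed.

Lemma ideal_powM I t x y : ideal_pow I t x -> I y -> ideal_pow I t.+1 (x * y).
Proof. by move=> Ix Iy; apply: ideal_gen_inc; exists x, y. Qed.

(** Each [E t] being an ideal, only the products generating the powers need checking. *)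
Lemma ideal_pow_ind I (E : nat -> A -> Prop) :
  (forall t, is_ideal (E t)) -> E 0%N 1 ->
  (forall t x y, E t x -> I y -> E t.+1 (x * y)) ->
  forall t x, ideal_pow I t x -> E t x.
Proof.
move=> idE E1 EM; elim=> [|t IHt] x /=.
  by move=> _; rewrite -(mulr1 x); apply: idealMl.
apply: ideal_gen_min => // _ [y [z [Iy [Iz ->]]]].
by apply: EM => //; apply: IHt.
Qed.

Lemma ideal_powS I J t x :
  (forall y, I y -> J y) -> ideal_pow I t x -> ideal_pow J t x.
Proof.
move=> sIJ; move: t x; apply: ideal_pow_ind => // [t|t x y Jx /sIJ].
  exact: ideal_pow_ideal.
exact: ideal_powM.
Qed.

(** Generators are regrouped factor by factor, [(x x') (y1 y2) = (x y1) (x' y2)], by induction on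
    [t]. *)
Lemma ideal_pow_mul I J K :
  (forall x y, I x -> J y -> K (x * y)) ->
  forall t x y, ideal_pow I t x -> ideal_pow J t y -> ideal_pow K t (x * y).
Proof.
move=> IJK t x y Ix Jy; move: t x Ix y Jy.
have idK t := ideal_pow_ideal K t.
pose E t x := forall y, ideal_pow J t y -> ideal_pow K t (x * y).
apply: (@ideal_pow_ind I E) => // [t|t x x' Ex Ix' y].
- split=> [y _|x x' Ex Ex' y Jy|r x Ex y Jy].
  + by rewrite mul0r; apply: ideal0.
  + by rewrite mulrDl; apply: idealD; [|apply: Ex|apply: Ex'].
  + by rewrite -mulrA; apply: idealMl; [|apply: Ex].
- apply: (@ideal_gen_min _ (fun y => ideal_pow K t.+1 (x * x' * y))).
    split=> [|y1 y2|r y1]; first by rewrite mulr0; apply: ideal0.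
      by rewrite mulrDr; apply: idealD.
    by rewrite mulrCA; apply: idealMl.
  move=> _ [y1 [y2 [Jy1 [Jy2 ->]]]]; rewrite mulrACA.
  by apply: ideal_powM; [apply: Ex | apply: IJK].
Qed.

(** * Comaximal, maximal and prime ideals *)

Lemma comaximal_powl I J :
  is_ideal J -> (exists2 u, I u & J (1 - u)) ->
  forall t, exists2 u, ideal_pow I t u & J (1 - u).
Proof.
move=> idJ [u Iu Ju]; elim=> [|t [v Iv Jv]].
  by exists 1 => //; rewrite subrr; apply: ideal0.
exists (v * u); first exact: ideal_powM.
have -> : 1 - v * u = (1 - v) + v * (1 - u) by ring.
by apply: idealD => //; apply: idealMl.
Qed.

(** [comaximal_powl] applies twice: it raises [I] first, then [J] against the ideal [I^t]. *)
Lemma comaximal_pow I J t :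
  is_ideal I -> is_ideal J -> (exists2 u, I u & J (1 - u)) ->
  exists2 u, ideal_pow I t u & ideal_pow J t (1 - u).
Proof.
move=> idI idJ /(comaximal_powl idJ) /(_ t) [u Iu Ju].
have [|v Jv Iv] := @comaximal_powl J _ (ideal_pow_ideal I t) _ t.
  by exists (1 - u) => //; rewrite subKr.
by exists (1 - v) => //; rewrite subKr.
Qed.

Lemma maximal_inverse M x : is_maximal_ideal M -> ~ M x -> exists s, M (1 - s * x).
Proof.
move=> [idM M1 maxM] Mx.
(* The ideal tested against maximality is [M + (x)]. *)
have [||[s Ms]|JM] := maxM (fun y => exists s, M (y - s * x)).
- split=> [|y z [s Ms] [s' Ms']|r y [s Ms]].
  + by exists 0; rewrite mul0r subr0; apply: ideal0.
  + exists (s + s'); rewrite mulrDl opprD addrACA; exact: idealD.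
  + by exists (r * s); rewrite -mulrA -mulrBr; apply: idealMl.
- by move=> y My; exists 0; rewrite mul0r subr0.
- by exists s.
- by case: Mx; apply: JM; exists 1; rewrite mul1r subrr; apply: ideal0.
Qed.

Lemma maximal_prime M : is_maximal_ideal M -> is_prime_ideal M.
Proof.
move=> maxM; have [idM M1 _] := maxM; split=> // a b Mab.
have [|Ma] := classic (M a); [by left | right].
have [s Ms] := maximal_inverse maxM Ma.
apply: (idealBl idM (y := s * (a * b))); last exact: idealMl.
have -> : b - s * (a * b) = b * (1 - s * a) by ring.
exact: idealMl.
Qed.

(** The product of one element outside [P] from each [N i] lies in all of them, and primality keeps
    it outside [P]. *)
Lemma prime_capP (T : eqType) (N : T -> A -> Prop) P (s : seq T) :
  is_prime_ideal P -> (forall i, is_ideal (N i)) ->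
  (forall i, i \in s -> exists2 x, N i x & ~ P x) ->
  exists2 x, (forall i, i \in s -> N i x) & ~ P x.
Proof.
move=> [_ P1 PM] idN; elim: s => [|j s IHs] nsub; first by exists 1.
have [i si|x Nx Px] := IHs; first by apply: nsub; rewrite inE si orbT.
have [y Ny Py] := nsub j (mem_head _ _).
exists (x * y) => [i|/PM [] //]; rewrite inE => /predU1P [-> | si].
  exact: idealMl.
by apply: idealMr => //; apply: Nx.
Qed.

Lemma maximal_cap_pow (T : eqType) (N : T -> A -> Prop) (s : seq T) t x :
  (forall i, is_maximal_ideal (N i)) ->
  (forall i, i \in s -> ideal_pow (N i) t x) ->
  ideal_pow (fun y => forall i, i \in s -> N i y) t x.
Proof.
move=> maxN.
have idN i : is_ideal (N i) by case: (maxN i).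
elim: s => [_|j s IHs Nx].
  have one_pow : ideal_pow (fun y => forall i, i \in [::] -> N i y) t 1.
    elim: t => // t IHt; rewrite -(mulr1 1); exact: ideal_powM.
  by rewrite -(mulr1 x); apply: idealMl => //; apply: ideal_pow_ideal.
set J := fun y => forall i, i \in s -> N i y in IHs.
have Jx : ideal_pow J t x by apply: IHs => i si; apply: Nx; rewrite inE si orbT.
have idJ : is_ideal J.
  split=> [i _|y z Jy Jz i si|r y Jy i si]; first exact: ideal0.
    by apply: idealD => //; [apply: Jy | apply: Jz].
  by apply: idealMl => //; apply: Jy.
(* If some earlier [N i] lies in [N j], intersecting with [N j] changes nothing. Otherwise [J]
   escapes the prime [N j], so the two are comaximal. *)
have [[i si sij]|nsub] := classic (exists2 i, i \in s & forall y, N i y -> N j y).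
  apply: ideal_powS Jx => y Jy k; rewrite inE => /predU1P [-> | sk].
    by apply: sij; apply: Jy.
  exact: Jy.
have [i si|y Jy Ny] := prime_capP (maximal_prime (maxN j)) idN (s := s).
  apply: NNPP => no; apply: nsub; exists i => // y Ny.
  by apply: NNPP => nNy; apply: no; exists y.
have [z Nz] := maximal_inverse (maxN j) Ny.
have [|u Ju Nu] := @comaximal_pow J (N j) t idJ (idN j).
  by exists (z * y) => //; exact: (idealMl idJ).
have JNcap y1 y2 : J y1 -> N j y2 -> forall i, i \in j :: s -> N i (y1 * y2).
  move=> Jy1 Ny2 i; rewrite inE => /predU1P [-> | si]; first exact: idealMl.
  by apply: idealMr => //; apply: Jy1.
(* Both terms are products of an element of [J^t] and one of [(N j)^t]. *)
have -> : x = u * x + x * (1 - u) by ring.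
apply: idealD; first exact: ideal_pow_ideal.
  exact: (ideal_pow_mul JNcap) Ju (Nx j (mem_head _ _)).
exact: (ideal_pow_mul JNcap).
Qed.

(* The fractions a / b ^+ k, b the product of the denominators in gs, form a
   subalgebra containing gs. *)
Lemma G_ideal_witness P : is_G_ideal P ->
  exists2 b, ~ P b & forall y, ~ P y -> exists k a, P (b ^+ k - y * a).
Proof.
move=> [primeP [gs [gsP genP]]]; have [idP P1 PM] := primeP.
pose b := \prod_(g <- gs) g.2; exists b.
  rewrite /b big_seq; apply: (big_ind (fun x => ~ P x)) => //.
  by move=> x y nPx nPy /PM [].
suff frac (x : A * A) : frac_subalg P gs x ->
    ~ P x.2 /\ exists k a, P (b ^+ k * x.1 - x.2 * a).
  (* The fraction [1 / y] of the subalgebra gives the claim. *)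
  move=> y nPy; have [_ [k [a]]] := frac _ (genP 1 y nPy).
  by rewrite mulr1; exists k, a.
elim=> {x} [a|g gs_g|x y _ [nPx [k [a Pa]]] _ [nPy [l [a' Pa']]]
  |x y _ [nPx [k [a Pa]]] _ [nPy [l [a' Pa']]]
  |x y _ [nPx [k [a Pa]]] nPy Pxy] /=.
- by split=> //; exists 0%N, a; rewrite expr0 subrr; apply: ideal0.
- split; first exact: gsP.
  exists 1%N, (g.1 * \prod_(h <- rem g gs) h.2).
  rewrite /b (perm_big _ (perm_to_rem gs_g)) big_cons expr1.
  set c := \prod_(h <- _) _.
  have -> : g.2 * c * g.1 - g.2 * (g.1 * c) = 0 by ring.
  exact: ideal0.
- split=> [/PM []//|]; exists (k + l)%N, (a * b ^+ l + a' * b ^+ k).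
  rewrite exprD.
  have -> : b ^+ k * b ^+ l * (x.1 * y.2 + y.1 * x.2)
      - x.2 * y.2 * (a * b ^+ l + a' * b ^+ k)
    = b ^+ l * y.2 * (b ^+ k * x.1 - x.2 * a)
      + b ^+ k * x.2 * (b ^+ l * y.1 - y.2 * a') by ring.
  by apply: idealD => //; apply: idealMl.
- split=> [/PM []//|]; exists (k + l)%N, (a * a'); rewrite exprD.
  have -> : b ^+ k * b ^+ l * (x.1 * y.1) - x.2 * y.2 * (a * a')
    = b ^+ l * y.1 * (b ^+ k * x.1 - x.2 * a)
      + x.2 * a * (b ^+ l * y.1 - y.2 * a') by ring.
  by apply: idealD => //; apply: idealMl.
- split=> //; exists k, a.
  suff /PM [] : P (x.2 * (b ^+ k * y.1 - y.2 * a)) by [].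
  have -> : x.2 * (b ^+ k * y.1 - y.2 * a)
    = y.2 * (b ^+ k * x.1 - x.2 * a) - b ^+ k * (x.1 * y.2 - y.1 * x.2) by ring.
  by apply: idealB => //; apply: idealMl.
Qed.

End Ideals.

(** * Polynomials and their degrees modulo an ideal of coefficients *)

Section CoefIdeals.
Variable A : comNzRingType.
Implicit Types (I : A -> Prop).

(** For an ideal [I], this is the extended ideal [I[X]], the kernel of reduction modulo [I]. *)
Definition coef_ideal I : {poly A} -> Prop := fun p => forall i, I p`_i.

Lemma coef_ideal_ideal I : is_ideal I -> is_ideal (coef_ideal I).
Proof.
move=> idI; split=> [i|p q Ip Iq i|r p Ip i].
- by rewrite coef0; apply: ideal0.
- by rewrite coefD; apply: idealD.
- by rewrite coefM; apply: ideal_sum => // j _; apply: idealMl.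
Qed.

(* For f of degree d modulo I with regular leading coefficient, degrees modulo
   I add up. *)
Lemma coef_mulr_ideal I (f g : {poly A}) d k :
  is_ideal I -> (forall x, I (f`_d * x) -> I x) ->
  (forall i, (d < i)%N -> I f`_i) ->
  (forall i, (d + k <= i)%N -> I (f * g)`_i) ->
  forall i, (k <= i)%N -> I g`_i.
Proof.
move=> idI regf If Ifg.
suff H s : (forall i, (s + k <= i)%N -> I g`_i) -> forall i, (k <= i)%N -> I g`_i.
  apply: (H (size g)) => i le_i; rewrite nth_default; first exact: ideal0.
  exact: leq_trans (leq_addr _ _) le_i.
elim: s => // s IHs Ig; apply: IHs => i.
rewrite leq_eqVlt => /predU1P [<-|]; last exact: Ig.
apply: regf.
(* In degree [d + (s + k)] every term of the product other than [f_d g_(s+k)] is already known to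
   lie in [I]. *)
have lt_d : (d < (d + (s + k)).+1)%N by lia.
have := Ifg (d + (s + k))%N ltac:(lia).
rewrite coefM (bigD1 (Ordinal lt_d)) //= addKn -[X in X + _]opprK addrC.
move=> /(idealBr idI); rewrite -[X in _ -> I X]opprK => H.
apply: (idealN idI); apply: H; apply: ideal_sum => // j ne_jd.
have {}ne_jd : nat_of_ord j <> d by move=> eq_jd; case/eqP: ne_jd; apply: val_inj.
have := ltn_ord j => lt_j.
have [le_jd|/If] := leqP j d; last exact: idealMr.
by apply: idealMl => //; apply: Ig; lia.
Qed.

(** Long division where each step multiplies by [f_d] instead of dividing by it; degrees are counted
    modulo [I]. *)
Lemma pseudo_division_ideal I (f : {poly A}) d :
  is_ideal I -> (forall i, (d < i)%N -> I f`_i) ->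
  forall q, exists N u r, f`_d ^+ N *: q = u * f + r /\
    forall i, (d <= i)%N -> I r`_i.
Proof.
move=> idI If q.
have : forall i, (size q <= i)%N -> I q`_i.
  by move=> i le_i; rewrite nth_default //; apply: ideal0.
move: (size q) => n; elim: n q => [|n IHn] q Iq.
  by exists 0%N, 0, q; rewrite expr0 scale1r mul0r add0r; split=> // i _; apply: Iq.
have [lt_nd|le_dn] := ltnP n d.
  exists 0%N, 0, q; rewrite expr0 scale1r mul0r add0r; split=> // i le_di.
  by apply: Iq; lia.
have [|N [u [r [eq_r Ir]]]] := IHn (f`_d *: q - (q`_n *: 'X^(n - d)) * f).
  move=> i le_ni; rewrite coefB coefZ -scalerAl coefZ coefXnM.
  rewrite ifF; last by lia.
  move: le_ni; rewrite leq_eqVlt => /predU1P [<-|lt_ni].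
    rewrite subKn // mulrC subrr; exact: ideal0.
  apply: idealB => //; apply: idealMl => //; first exact: Iq.
  by apply: If; lia.
exists N.+1, (u + f`_d ^+ N *: (q`_n *: 'X^(n - d))), r; split=> //.
by rewrite exprSr -scalerA mulrDl addrAC -eq_r scalerBr -!scalerAl subrK.
Qed.

(** The polynomial [f] plays the part of a minimal polynomial of [J] modulo [I]: remainders after
    division by it vanish modulo [I] once they lie in [J]. *)
Lemma least_degree_ideal I (J : {poly A} -> Prop) :
  is_ideal I -> (exists2 q, J q & ~ coef_ideal I q) ->
  exists d f, [/\ J f, ~ I f`_d, (forall i, (d < i)%N -> I f`_i) &
    forall r, J r -> (forall i, (d <= i)%N -> I r`_i) -> coef_ideal I r].
Proof.
move=> idI [q Jq Iq].
(* [bound] measures degree plus one, so that its least value is a successor. *)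
pose bound d := exists f, [/\ J f, ~ coef_ideal I f & forall i, (d <= i)%N -> I f`_i].
have [|[|d] [[f [Jf nIf If]] least_d]] := @ex_least bound.
- exists (size q), q; split=> // i le_i.
  by rewrite nth_default //; apply: ideal0.
- by case: nIf => i; apply: If.
exists d, f; split=> // [If_d|r Jr Ir].
  suff /least_d : bound d by rewrite ltnn.
  exists f; split=> // i; rewrite leq_eqVlt => /predU1P [<- //|]; exact: If.
apply: NNPP => nIr; suff /least_d : bound d by rewrite ltnn.
by exists r.
Qed.

Lemma coef_ideal_pow I t q :
  ideal_pow (coef_ideal I) t q -> coef_ideal (ideal_pow I t) q.
Proof.
move: t q; apply: (@ideal_pow_ind _ _ (fun t => coef_ideal (ideal_pow I t))) => //.
  by move=> t; exact/coef_ideal_ideal/ideal_pow_ideal.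
move=> t x y Ix Iy i; rewrite coefM.
apply: (ideal_sum (ideal_pow_ideal I t.+1)) => j _.
exact: ideal_powM.
Qed.

End CoefIdeals.

(** * Contraction of ideals and of their powers from [{poly R}] to [R] *)

Section Contraction.
Variable R : idomainType.
Implicit Types (Q : {poly R} -> Prop).

Lemma contract_ideal Q : is_ideal Q -> is_ideal (contract Q).
Proof.
move=> idQ; split=> [|x y Qx Qy|r x Qx]; rewrite /contract.
- by rewrite polyC0; apply: ideal0.
- by rewrite polyCD; apply: idealD.
- by rewrite polyCM; apply: idealMl.
Qed.

Lemma contract_prime Q : is_prime_ideal Q -> is_prime_ideal (contract Q).
Proof.
move=> [idQ Q1 QM]; split=> [||a b]; first exact: contract_ideal.
  by rewrite /contract polyC1.
by rewrite /contract polyCM; apply: QM.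
Qed.

Lemma coef_ideal_contract Q q : is_ideal Q -> coef_ideal (contract Q) q -> Q q.
Proof.
move=> idQ Qq; rewrite -[q]coefK poly_def; apply: ideal_sum => // i _.
by rewrite -mul_polyC; apply: idealMr => //; apply: Qq.
Qed.

(** For [d = 0], [f] would be constant modulo the extension of [contract Q], forcing this constant
    into [Q]. *)
Lemma contract_degree_gt0 Q f d :
  is_ideal Q -> Q f -> ~ contract Q f`_d ->
  (forall i, (d < i)%N -> contract Q f`_i) -> (0 < d)%N.
Proof.
move=> idQ Qf nQf Qfi; case: d => // in nQf Qfi *.
case: nQf; apply: (idealBr idQ _ Qf).
apply: coef_ideal_contract => // i; rewrite coefB coefC.
case: eqP => [->|/eqP]; last by rewrite subr0 -lt0n; apply: Qfi.
by rewrite subrr; apply: (ideal0 (contract_ideal idQ)).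
Qed.

(* If Q were extended from R, then 1 + X b would divide a power of b modulo
   Q, hence also 1, although it has positive degree. *)
Lemma G_ideal_not_extended Q : is_G_ideal Q ->
  exists2 q, Q q & ~ coef_ideal (contract Q) q.
Proof.
move=> GQ; have [b nQb Qb] := G_ideal_witness GQ.
have [primeQ _] := GQ; have [idQ Q1 _] := primeQ.
have idp := contract_ideal idQ.
apply: NNPP => nocoef.
have Qp q : Q q -> coef_ideal (contract Q) q.
  by move=> Qq; apply: NNPP => nQq; apply: nocoef; exists q.
(* Taking the singleton of [b] for [J] reads off the degree [d] of [b] modulo [contract Q]. *)
have [|d [_ [<- pb_d pb _]]] := @least_degree_ideal _ (contract Q) (eq b) idp.
  by exists b => // pb; apply: nQb; exact: (coef_ideal_contract idQ pb).
pose y := 1 + 'X * b.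
have y_coef i : y`_i.+1 = b`_i by rewrite coefD coef1 coefXM add0r.
have nQy : ~ Q y by move=> /Qp /(_ d.+1); rewrite y_coef.
have [k [a Qba]] := Qb y nQy.
(* The geometric sum inverts [y] up to [(- X b)^k], and [b^k] is a multiple of [y] modulo [Q]. *)
have [v Qv] : exists v, Q (1 - y * v).
  exists ((\sum_(i < k) 1 ^+ (k.-1 - i) * (- ('X * b)) ^+ i) + (- 'X) ^+ k * a).
  have -> : y = 1 - - ('X * b) by rewrite opprK.
  rewrite mulrDr -subrXX expr1n opprK -/y.
  have -> : 1 - (1 - (- ('X * b)) ^+ k + y * ((- 'X) ^+ k * a))
      = (- 'X) ^+ k * (b ^+ k - y * a).
    by rewrite -mulNr exprMn; ring.
  exact: idealMl.
(* Modulo [contract Q], [y v = 1] while [y] has degree [d + 1 > 0], so [v] vanishes. *)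
have pv : coef_ideal (contract Q) v.
  move=> i; apply: (@coef_mulr_ideal _ (contract Q) y v d.+1 0) => //.
  - move=> x; rewrite y_coef.
    by have [_ _ pM] := contract_prime primeQ; case/pM.
  - by case=> // j; rewrite ltnS y_coef => /pb.
  - case=> // j _; move: (Qp _ Qv j.+1).
    by rewrite coefB coef1 sub0r => /(idealN idp); rewrite opprK.
apply: Q1; apply: (idealBl idQ Qv); apply: idealMl => //.
exact: coef_ideal_contract.
Qed.

(** A member [g] of [Q + (b)] of least degree modulo [contract Q] must be constant there. Otherwise
    [g] pseudo-divides the minimal [f] of [Q], and primality puts the quotient or [g] itself in [Q];
    both contradict minimality or [~ Q b]. *)
Lemma prime_bezout Q b :
  is_prime_ideal Q -> (exists2 q, Q q & ~ coef_ideal (contract Q) q) -> ~ Q b ->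
  exists h c, ~ contract Q c /\ Q (b * h - c%:P).
Proof.
move=> primeQ noext nQb; have [idQ Q1 QM] := primeQ.
have idp := contract_ideal idQ.
pose J g := exists h, Q (b * h - g).
have QJ g : Q g -> J g.
  by move=> Qg; exists 0; rewrite mulr0 sub0r; apply: idealN.
have Jb : J b by exists 1; rewrite mulr1 subrr; apply: ideal0.
have JB u g r : J g -> J (u * g + r) -> J r.
  move=> [h Qh] [h' Qh']; exists (h' - u * h).
  have -> : b * (h' - u * h) - r = (b * h' - (u * g + r)) - u * (b * h - g) by ring.
  by apply: idealB => //; apply: idealMl.
have JZ x g : J g -> J (x *: g).
  move=> [h Qh]; exists (x *: h); rewrite -scalerAr -scalerBr -mul_polyC.
  exact: idealMl.
have [d [f [Qf pf_d pf min_f]]] := least_degree_ideal idp noext.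
have [|e [g [Jg pg_e pg min_g]]] := least_degree_ideal (J := J) idp.
  by exists b => // pb; apply: nQb; exact: (coef_ideal_contract idQ pb).
have nQX x k : ~ contract Q x -> ~ contract Q (x ^+ k).
  exact/prime_idealX/contract_prime.
case: e => [|e] in pg_e pg min_g *.
  have [h Qh] := Jg; exists h, g`_0; split=> //.
  have -> : b * h - (g`_0)%:P = (b * h - g) + (g - (g`_0)%:P) by ring.
  apply: idealD => //; apply: coef_ideal_contract => // i.
  rewrite coefB coefC; case: eqP => [->|/eqP].
    by rewrite subrr; apply: ideal0.
  by rewrite subr0 -lt0n; apply: pg.
have [N [u [r [eq_r pr]]]] := pseudo_division_ideal idp pg f.
have pr_all : coef_ideal (contract Q) r.
  by apply: min_g => //; apply: (JB u g) => //; rewrite -eq_r; apply/JZ/QJ.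
have ugE : u * g = g`_e.+1 ^+ N *: f - r by rewrite eq_r addrK.
have [Qu|Qg] : Q u \/ Q g.
- apply: QM; rewrite ugE -mul_polyC; apply: idealB => //; first exact: idealMl.
  exact: coef_ideal_contract.
(* Since [g] has positive degree, the quotient [u] has degree below that of [f], hence vanishes
   modulo [contract Q]. *)
- have pu : coef_ideal (contract Q) u.
    apply: min_f => //; apply: (coef_mulr_ideal (f := g) (d := e.+1) idp) => // [x|i le_i].
      by have [_ _ pM] := contract_prime primeQ; case/pM.
    rewrite mulrC ugE coefB coefZ; apply: idealB => //; apply: idealMl => //.
    by apply: pf; lia.
  have : contract Q (g`_e.+1 ^+ N * f`_d).
    rewrite -coefZ eq_r coefD; apply: idealD => //.
    by rewrite coefM; apply: ideal_sum => // j _; apply: idealMr.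
  by have [_ _ pM] := contract_prime primeQ; case/pM => // /nQX.
- have le_de : (d <= e.+1)%N.
    rewrite leqNgt; apply/negP => lt_ed; apply: pg_e; apply: min_f => // i le_di.
    by apply: pg; apply: leq_trans le_di.
  (* The remainder of [b] by [f] lies in [Q + (b)] with degree below that of [g], so it vanishes
     modulo [contract Q] and [b] falls into [Q]. *)
  have [L [v [w [eq_w pw]]]] := pseudo_division_ideal idp pf b.
  have Qw : Q w.
    apply: coef_ideal_contract => //; apply: min_g => [|i le_i].
      by apply: (JB v f); [apply: QJ | rewrite -eq_w; apply: JZ].
    by apply: pw; apply: leq_trans le_i.
  have : Q ((f`_d ^+ L)%:P * b).
    by rewrite mul_polyC eq_w; apply: idealD => //; apply: idealMl.
  by case/QM => // /(nQX _ _ pf_d).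
Qed.

Lemma G_ideal_contract_maximal Q :
  hilbert_ring R -> is_G_ideal Q -> is_maximal_ideal (contract Q).
Proof.
move=> hR GQ; have [b nQb Qb] := G_ideal_witness GQ.
have noext := G_ideal_not_extended GQ.
have [primeQ _] := GQ; have [idQ Q1 _] := primeQ.
have primep := contract_prime primeQ; have [idp p1 pM] := primep.
have [h [c [pc Qc]]] := prime_bezout primeQ noext nQb.
have [d [f [Qf pf_d pf min_f]]] := least_degree_ideal idp noext.
have d_gt0 := contract_degree_gt0 idQ Qf pf_d pf.
have [F [maxF capF]] := hR _ primep.
have [M FM nM] : exists2 M, F M & ~ M (f`_d * c).
  apply: NNPP => noM; suff /pM [] : contract Q (f`_d * c) by [].
  by apply/capF => M FM; apply: NNPP => nM; apply: noM; exists M.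
have maxM := maxF M FM; have primeM := maximal_prime maxM.
have [idM M1 MM] := primeM.
have sub_pM x : contract Q x -> M x by move=> /capF; apply.
have nMf : ~ M f`_d by move=> Mf; apply: nM; apply: idealMr.
have nMc : ~ M c by move=> Mc; apply: nM; apply: idealMl.
(* The converse inclusion [sub_pM] is known, so the two ideals then coincide. *)
suff sub_Mp x : M x -> contract Q x.
  have [_ _ max] := maxM; split=> // J idJ sub_pJ.
  have [x /sub_Mp|J1|JM] := max J idJ; [exact: sub_pJ | by left |].
  by right=> x /JM /sub_Mp.
move=> My; apply: NNPP => nQy.
have [k [g Qg]] := Qb x%:P nQy.
(* Modulo [Q], [c^k] is [(b h)^k], and [b^k] is [x g]. *)
pose q := (c ^+ k)%:P - x%:P * (g * h ^+ k).
have Qq : Q q.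
  have -> : q = h ^+ k * (b ^+ k - x%:P * g) - ((b * h) ^+ k - (c%:P) ^+ k).
    by rewrite /q rmorphXn exprMn /=; ring.
  apply: idealB => //; first exact: idealMl.
  exact: ideal_subX.
have [N [u [r [eq_r pr]]]] := pseudo_division_ideal idp pf q.
have Mr i : M r`_i.
  apply: sub_pM; apply: min_f => //; apply: (idealBr idQ (x := f`_d ^+ N *: q)).
    rewrite eq_r addrK; exact: idealMl.
  by rewrite -mul_polyC; apply: idealMl.
have fuE i : (f * u)`_i = f`_d ^+ N * (c ^+ k *+ (i == 0%N))
    - (f`_d ^+ N * (x * (g * h ^+ k)`_i) + r`_i).
  rewrite mulrC (_ : u * f = f`_d ^+ N *: q - r); last by rewrite eq_r addrK.
  rewrite coefB coefZ coefB coefC coefCM.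
  by case: eqP => _; rewrite ?mulr1n ?mulr0n; ring.
have Mt i : M (f`_d ^+ N * (x * (g * h ^+ k)`_i) + r`_i).
  by apply: idealD => //; apply: idealMl => //; apply: idealMr.
(* Modulo [M] the product [f u] is the constant [f_d^N c^k], while [f] keeps its positive degree
   [d]; hence [u] vanishes. *)
have Mu i : M u`_i.
  apply: (@coef_mulr_ideal _ M f u d 0) => // [y /MM []//|j /pf /sub_pM //|j].
  rewrite addn0 => le_dj; rewrite fuE gtn_eqF ?(leq_trans d_gt0) // mulr0 sub0r.
  exact: idealN.
have : M (f`_d ^+ N * c ^+ k).
  have := fuE 0%N; rewrite eqxx mulr1n => /esym /eqP; rewrite subr_eq => /eqP ->.
  apply: idealD => //; rewrite coefM; apply: ideal_sum => // j _.
  exact: idealMl.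
by case/MM; apply: prime_idealX.
Qed.

Lemma contract_ideal_pow Q t r :
  is_ideal Q -> is_maximal_ideal (contract Q) ->
  contract (ideal_pow Q t) r -> ideal_pow (contract Q) t r.
Proof.
move=> idQ maxp; have [idp p1 _] := maxp.
have idpt t := ideal_pow_ideal (contract Q) t.
have [Qp|noext] := classic (forall q, Q q -> coef_ideal (contract Q) q).
  by move=> /(ideal_powS Qp) /coef_ideal_pow /(_ 0%N); rewrite coefC.
have {noext} : exists2 q, Q q & ~ coef_ideal (contract Q) q.
  apply: NNPP => no; apply: noext => q Qq; apply: NNPP => nQq; apply: no.
  by exists q.
move=> /(least_degree_ideal idp) [d [f0 [Qf0 pf0_d pf0 min_f0]]].
have d_gt0 := contract_degree_gt0 idQ Qf0 pf0_d pf0.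
have [s ps] := maximal_inverse maxp pf0_d.
(* A truly monic polynomial congruent to [s f0] modulo [contract Q]. *)
pose f := 'X^d + \poly_(i < d) (s * f0`_i).
have f_d : f`_d = 1 by rewrite coefD coefXn eqxx coef_poly ltnn addr0.
have f_gt i : (d < i)%N -> f`_i = 0.
  by move=> lt_di; rewrite coefD coefXn coef_poly gtn_eqF // ltnNge ltnW // addr0.
have Qf : Q f.
  apply: (idealBl idQ (y := s%:P * f0)); last exact: idealMl.
  apply: coef_ideal_contract => // i; rewrite coefB coefCM.
  have [lt_id|lt_di|->] := ltngtP i d.
  - rewrite coefD coefXn coef_poly lt_id ltn_eqF // add0r subrr; exact: ideal0.
  - by rewrite f_gt // sub0r; apply: idealN => //; apply: idealMl => //; apply: pf0.
  - by rewrite f_d.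
(* [E k] is the ideal [p^k[X] + (f)] for [p = contract Q]. *)
pose E k q := exists a g, q = a + f * g /\ coef_ideal (ideal_pow (contract Q) k) a.
have /(_ t r%:P) EQ : forall k q, ideal_pow Q k q -> E k q.
  apply: (@ideal_pow_ind _ _ E) => [k||k x y [a [g [-> pa]]] Qy].
  - have idck := coef_ideal_ideal (idpt k).
    split=> [|_ _ [a [g [-> pa]]] [a' [g' [-> pa']]]|x _ [a [g [-> pa]]]].
    + by exists 0, 0; rewrite mulr0 addr0; split=> //; apply: ideal0.
    + by exists (a + a'), (g + g'); split; [ring | apply: (idealD idck)].
    + by exists (x * a), (x * g); split; [ring | apply: (idealMl idck)].
  - by exists 1, 0; rewrite mulr0 addr0.
  (* The remainder [r'] of [y] by [f] lies in [Q] and has degree below [d] modulo [p], hence lies in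
     [p[X]]. *)
  have [|N [u [r' [eq_r pr]]]] := @pseudo_division_ideal _ (contract Q) f d idp _ y.
    by move=> i /f_gt ->; apply: ideal0.
  move: eq_r; rewrite f_d expr1n scale1r => eq_y.
  exists (a * r'), (a * u + g * y); split; first by rewrite {1}eq_y eq_y; ring.
  move=> i; rewrite coefM; apply: ideal_sum => // j _; apply: ideal_powM => //.
  apply: min_f0 => //; apply: (idealBr idQ (x := y)) => //.
  by rewrite eq_y addrK; apply: idealMl.
move=> /EQ [a [g [eq_r pa]]].
(* As [r] is constant, [f g] agrees with [-a] in degrees at least [d > 0]; [f] being monic, [g] has
   coefficients in [p^t]. *)
have pg i : ideal_pow (contract Q) t g`_i.
  apply: (@coef_mulr_ideal _ _ f g d 0) => // [x|j /f_gt ->|j].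
  - by rewrite f_d mul1r.
  - exact: ideal0.
  rewrite addn0 => le_dj.
  have -> : (f * g)`_j = - a`_j.
    apply/eqP; rewrite -addr_eq0 -coefD addrC -eq_r coefC gtn_eqF //.
    exact: leq_trans d_gt0 le_dj.
  exact: idealN.
have := congr1 (fun q : {poly R} => q`_0) eq_r.
rewrite /= coefC eqxx coefD => ->; apply: idealD => //.
rewrite coefM; apply: ideal_sum => // j _; exact: idealMl.
Qed.

End Contraction.

Theorem theorem3p10 (R : idomainType) (hR : hilbert_ring R)
    (I : {poly R} -> Prop) (hI : is_radical_ideal I)
    (n : nat) (Q : 'I_n -> ({poly R} -> Prop))
    (hQ : forall i, is_G_ideal (Q i))
    (hIQ : forall p, I p <-> (forall i, Q i p)) :
  power_stable I.
Proof.
move=> t _ r; split=> [It|]; last first.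
  (* Products of constants from [I] are products in [I], whence the inclusion valid for any
     ideal. *)
  move: t r; apply: (@ideal_pow_ind _ _ (fun t => contract (ideal_pow I t)))
    => [t||t x y Ix Iy] //.
    exact/contract_ideal/ideal_pow_ideal.
  by rewrite /contract polyCM; apply: ideal_powM.
have maxQ i := G_ideal_contract_maximal hR (hQ i).
apply: (@ideal_powS _ (fun y => forall i, i \in enum 'I_n -> contract (Q i) y)).
  by move=> y Qy; apply/hIQ => i; apply: Qy; rewrite mem_enum.
apply: maximal_cap_pow => // i _; have [[idQ _ _] _] := hQ i.
(* [I^t] lies in each [(Q i)^t], which contracts into the power of a maximal ideal. *)
apply: contract_ideal_pow => //; apply: ideal_powS It => q /hIQ; exact.
Qed.
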